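(* For any complete graph $K_n$ of order $n \geq 3$, $$\tilde{\gamma}_{c}(M(K_n)) = \lceil n/2 \rceil.$$
   Context: All graphs are non-empty, finite, undirected and simple. The order of a graph is its number of vertices. A dominating set of a graph $H$ is a set $S \subseteq V(H)$ such that $N_H[v] \cap S \neq \emptyset$ for every $v \in V(H)$, where $N_H[v]$ is the closed neighborhood of $v$. A dominating set $S$ of $H$ is an outer-connected dominating set if the graph $H - S$ (obtained by deleting the vertices in $S$) is connected. The outer-connected domination number $\tilde{\gamma}_c(H)$ is the minimum cardinality of an outer-connected dominating set of $H$. The middle graph $M(G)$ of a graph $G$ is the graph with vertex set $V(G) \cup E(G)$ (disjoint union), in which two vertices $x,y$ are adjacent if and only if either $x,y \in E(G)$ are distinct edges sharing an endpoint in $G$, or one of them is a vertex of $G$ and the other is an edge of $G$ incident with it. *)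

(* Defs.v *)
From mathcomp Require Import all_boot.

Set Implicit Arguments.
Unset Strict Implicit.
Unset Printing Implicit Defensive.

(* Finite simple graphs. The vertex set may be empty here, so that deleting   *)
(* every vertex still yields a value of this type; non-emptiness is required  *)
(* by [connected].                                                            *)
Record sgraph := SGraph {
  vertex :> finType;
  adj : rel vertex;
  adj_sym : symmetric adj;
  adj_irr : irreflexive adj
}.

Definition complete (G : sgraph) : Prop :=
  forall x y : G, x != y -> adj x y.

Definition connected (G : sgraph) : bool :=
  (0 < #|G|) && [forall x : G, forall y : G, connect (@adj G) x y].

Definition closed_nbhd (G : sgraph) (v : G) : {set G} :=
  [set u | (u == v) || adj v u].

Definition dominating (G : sgraph) (S : {set G}) : bool :=
  [forall v : G, closed_nbhd v :&: S != set0].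

Section Deletion.
Variables (G : sgraph) (S : {set G}).

Definition del_vertex : finType := {v : G | v \notin S}.
Definition del_adj : rel del_vertex := fun u v => adj (val u) (val v).

Lemma del_adj_sym : symmetric del_adj.
Proof. by move=> u v; apply: adj_sym. Qed.

Lemma del_adj_irr : irreflexive del_adj.
Proof. by move=> u; apply: adj_irr. Qed.

Definition del_graph : sgraph := SGraph del_adj_sym del_adj_irr.
End Deletion.

Definition outer_connected_dominating (G : sgraph) (S : {set G}) : bool :=
  dominating S && connected (del_graph S).

(* The default value #|G| is never smaller than a competing cardinality, so   *)
(* this is the minimum whenever an outer-connected dominating set exists; see *)
(* [outer_connected_domination_numberP].                                      *)
Definition outer_connected_domination_number (G : sgraph) : nat :=
  \big[minn/#|G|]_(S : {set G} | outer_connected_dominating S) #|S|.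

Lemma outer_connected_domination_numberP (G : sgraph) (k : nat) :
  (exists S : {set G}, outer_connected_dominating S) ->
  outer_connected_domination_number G = k <->
  (exists2 S : {set G}, outer_connected_dominating S & #|S| = k) /\
  (forall S : {set G}, outer_connected_dominating S -> k <= #|S|).
Proof.
move=> [S0 S0P]; set g := outer_connected_domination_number G.
have g_le (S : {set G}) : outer_connected_dominating S -> g <= #|S|.
  move=> SP; rewrite /g /outer_connected_domination_number.
  elim: (index_enum _) (mem_index_enum S) => // T r IHr.
  rewrite inE big_cons => /predU1P[<- | /IHr le_r]; first by rewrite SP geq_minl.
  by case: ifP => // _; rewrite geq_min le_r orbT.
have g_att : exists2 S : {set G}, outer_connected_dominating S & #|S| = g.
  have: g = #|G| \/
    exists2 S : {set G}, outer_connected_dominating S & #|S| = g.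
    rewrite /g /outer_connected_domination_number.
    apply: (big_ind (fun m => m = #|G| \/
      exists2 S : {set G}, outer_connected_dominating S & #|S| = m)).
    - by left.
    - by move=> m n Hm Hn; rewrite /minn; case: ifP.
    - by move=> S SP; right; exists S.
  case=> // gE; exists S0 => //; apply/eqP.
  by rewrite eqn_leq g_le // gE max_card.
split=> [<- // | [[S SP Sk] kmin]]; apply/eqP.
case: g_att => T TP Tg.
by rewrite eqn_leq -{1}Sk g_le //= -Tg kmin.
Qed.

Definition edges (G : sgraph) : {set {set G}} :=
  [set e | [exists x : G, exists y : G, adj x y && (e == [set x; y])]].

Section MiddleGraph.
Variable G : sgraph.

Definition middle_vertex : finType := (G + {e : {set G} | e \in edges G})%type.

Definition middle_adj : rel middle_vertex := fun a b =>
  match a, b with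
  | inl _, inl _ => false
  | inl v, inr e => v \in val e
  | inr e, inl v => v \in val e
  | inr e, inr f => (e != f) && (val e :&: val f != set0)
  end.

Lemma middle_adj_sym : symmetric middle_adj.
Proof. by move=> [v|e] [w|f] //=; rewrite eq_sym setIC. Qed.

Lemma middle_adj_irr : irreflexive middle_adj.
Proof. by move=> [v|e] //=; rewrite eqxx. Qed.

Definition middle_graph : sgraph := SGraph middle_adj_sym middle_adj_irr.
End MiddleGraph.

(* Main.v *)
Require Import Defs.
From mathcomp Require Import all_boot.

Set Implicit Arguments.
Unset Strict Implicit.
Unset Printing Implicit Defensive.

(** Send each vertex [v] of [M(G)] coming from [G] to [{v}], and each vertex
    coming from an edge to its pair of end-points. Two distinct vertices of
    [M(G)] are adjacent exactly when these subsets of [G] meet, so [M(G)] is an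
    intersection graph ([closed_nbhd_middle]), and domination and connectivity
    become statements about sets of size at most two.

    Lower bound: a dominating set [S] yields [#|S|] such subsets covering [G],
    so [#|G| <= 2 * #|S|] ([dominating_middle_lower_bound]).

    Upper bound: split [K_n] into [uphalf n] blocks of size at most two. In a
    complete graph every block is the subset attached to a vertex of [M(K_n)];
    let [S] consist of these vertices. The blocks cover [K_n], so [S]
    dominates. A pair of vertices from different blocks is an edge that is not
    in [S], and as [n >= 3] there are always at least two blocks, so such edges
    link any two vertices that survive the deletion of [S]. *)

Section IntersectionModel.
Variable G : sgraph.

Definition trace (a : middle_graph G) : {set G} :=
  match a with inl v => [set v] | inr e => val e end.

Lemma edgeP (e : {e : {set G} | e \in edges G}) :
  exists x y : G, x != y /\ val e = [set x; y].
Proof.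
case: e => e /=; rewrite inE => /existsP[x /existsP[y /andP[xy /eqP->]]].
by exists x, y; split=> //; apply: contraTneq xy => ->; rewrite adj_irr.
Qed.

Lemma trace_inhabited (a : middle_graph G) : exists x, x \in trace a.
Proof.
case: a => [v|e] /=; first by exists v; rewrite set11.
by have [x [y [_ ->]]] := edgeP e; exists x; rewrite set21.
Qed.

Lemma card_trace (a : middle_graph G) : #|trace a| <= 2.
Proof.
case: a => [v|e] /=; first by rewrite cards1.
by have [x [y [_ ->]]] := edgeP e; rewrite cards2; case: eqP.
Qed.

Lemma trace_inj : injective trace.
Proof.
have mixed v (e : {e : {set G} | e \in edges G}) : [set v] <> val e :> {set G}.
  have [x [y [xy ->]]] := edgeP e => eq_ve.
  by have := cards1 v; rewrite eq_ve cards2 xy.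
move=> [v|e] [w|f] /=.
- by move/set1_inj->.
- by move/mixed.
- by move/esym/mixed.
- by move/val_inj->.
Qed.

(** Closed neighborhoods are used because the case [c = a] then needs no
    exception: a trace is nonempty, so it meets itself. *)
Lemma closed_nbhd_middle (a c : middle_graph G) :
  (c \in closed_nbhd a) = (trace a :&: trace c != set0).
Proof.
rewrite inE; have [->|ca] /= := eqVneq c a.
  have [x xa] := trace_inhabited a.
  by symmetry; apply/set0Pn; exists x; rewrite setIid.
case: a c ca => [v|e] [w|f] //= ca.
- by apply/esym/negbTE/negPn/eqP/setP=> x; rewrite !inE;
    apply: contraNF ca => /andP[/eqP<- /eqP<-].
- apply/idP/set0Pn => [vf|[x]]; first by exists v; rewrite !inE eqxx.
  by rewrite !inE => /andP[/eqP->].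
- apply/idP/set0Pn => [we|[x]]; first by exists w; rewrite !inE eqxx andbT.
  by rewrite !inE => /andP[xe /eqP<-].
- by rewrite eq_sym in ca; rewrite (_ : e != f).
Qed.

(** Dominating the original vertices already forces the traces of [S] to cover
    [G], and each of them covers at most two vertices. *)
Lemma dominating_middle_lower_bound (S : {set middle_graph G}) :
  dominating S -> uphalf #|G| <= #|S|.
Proof.
move=> /forallP domS; rewrite leq_uphalf_double -mul2n mulnC.
have cover_S : [set: G] \subset \bigcup_(a in S) trace a.
  apply/subsetP=> v _; have /set0Pn[a] := domS (inl v).
  rewrite inE closed_nbhd_middle /= => /andP[/set0Pn[x]].
  by rewrite inE in_set1 => /andP[/eqP-> va] aS; apply/bigcupP; exists a.
rewrite -cardsT; apply: leq_trans (subset_leq_card cover_S) _.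
rewrite -sum_nat_const.
apply: (big_ind2 (fun (A : {set G}) m => #|A| <= m)) => [|A m B p Am Bp|a _].
- by rewrite cards0.
- by apply: leq_trans (leq_add Am Bp); apply: leq_card_setU.
- exact: card_trace.
Qed.

End IntersectionModel.

Section Blocks.
Variables (G : sgraph) (k : nat) (b : G -> 'I_k).

Definition block (i : 'I_k) : {set G} := [set y | b y == i].

Definition block_set : {set middle_graph G} :=
  [set a | [exists x, trace a == block (b x)]].

(** A vertex of [M(G)] is determined by its trace, so [block_set] has no more
    elements than there are blocks. *)
Lemma card_block_set : #|block_set| <= k.
Proof.
rewrite -(card_imset _ (@trace_inj G)).
have sub : (@trace G) @: block_set \subset block @: [set: 'I_k].
  apply/subsetP=> _ /imsetP[a aS ->].
  have := aS; rewrite inE => /existsP[x /eqP->].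
  by apply/imsetP; exists (b x).
apply: leq_trans (subset_leq_card sub) _.
by apply: leq_trans (leq_imset_card _ _) _; rewrite cardsT card_ord.
Qed.

Hypotheses (G_complete : complete G) (G_ge3 : 3 <= #|G|).
Hypothesis card_block : forall i, #|block i| <= 2.

Lemma edge_of_pair (x y : G) :
  x != y -> exists a : middle_graph G, trace a = [set x; y].
Proof.
move=> xy; have xyE : [set x; y] \in edges G.
  rewrite inE; apply/existsP; exists x; apply/existsP; exists y.
  by rewrite G_complete ?eqxx.
by exists (inr (Sub [set x; y] xyE)).
Qed.

(** Blocks have one or two elements, and completeness makes every two-element
    block an edge. *)
Lemma block_trace (x : G) :
  exists2 a, a \in block_set & trace a = block (b x).
Proof.
suff [a aE] : exists a : middle_graph G, trace a = block (b x).
  by exists a => //; rewrite inE; apply/existsP; exists x; rewrite aE.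
have xB : x \in block (b x) by rewrite inE.
have [eqB|[y]] := set_0Vmem (block (b x) :\ x).
  by exists (inl x); rewrite /= -(setD1K xB) eqB setU0.
rewrite !inE => /andP[yx yB].
have [a aE] : exists a : middle_graph G, trace a = [set x; y].
  by apply: edge_of_pair; rewrite eq_sym.
exists a; rewrite aE; apply/eqP; rewrite eqEcard cards2 eq_sym yx card_block.
by rewrite andbT; apply/subsetP=> z; rewrite !inE => /orP[]/eqP->.
Qed.

Lemma block_set_dominating : dominating block_set.
Proof.
apply/forallP=> a; have [x xa] := trace_inhabited a.
have [c cS cE] := block_trace x; apply/set0Pn; exists c.
rewrite inE cS closed_nbhd_middle cE andbT.
by apply/set0Pn; exists x; rewrite !inE xa eqxx.
Qed.

Lemma other_block (x : G) : exists y, b x != b y.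
Proof.
have : 0 < #|~: block (b x)|.
  rewrite cardsCs setCK subn_gt0.
  by apply: leq_ltn_trans (card_block _) G_ge3.
by case/card_gt0P=> y; rewrite !inE eq_sym; exists y.
Qed.

(** The traces of the deleted vertices are blocks, and a pair that straddles
    two blocks is not a block. *)
Lemma surviving_cross_edge (x y : G) :
  b x != b y ->
  exists u : del_graph block_set, trace (val u) = [set x; y].
Proof.
move=> bxy; have [|a aE] := @edge_of_pair x y.
  by apply: contraNneq bxy => ->.
suff aS : a \notin block_set by exists (Sub a aS).
rewrite inE aE negb_exists; apply/forallP=> z.
apply: contraNneq bxy => /setP eqB.
have := eqB x; have := eqB y; rewrite !inE !eqxx orbT /=.
by move=> /esym/eqP-> /esym/eqP->.
Qed.

Lemma connect_meet (u v : del_graph block_set) (x : G) :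
  x \in trace (val u) -> x \in trace (val v) -> connect (@adj _) u v.
Proof.
move=> xu xv; have : val v \in closed_nbhd (val u).
  by rewrite closed_nbhd_middle; apply/set0Pn; exists x; rewrite inE xu.
rewrite inE => /predU1P[/val_inj-> | uv]; first exact: connect0.
exact: connect1.
Qed.

Lemma block_set_outer_connected : connected (del_graph block_set).
Proof.
have link (u v : del_graph block_set) (x z : G) :
    x \in trace (val u) -> z \in trace (val v) -> b x != b z ->
    connect (@adj _) u v.
  move=> xu zv /surviving_cross_edge[w wE].
  apply: (@connect_trans _ _ w).
    by apply: connect_meet xu _; rewrite wE set21.
  by apply: connect_meet _ zv; rewrite wE set22.
apply/andP; split.
  have /card_gt0P[x _] := ltnW (ltnW G_ge3); have [y bxy] := other_block x.
  by have [u _] := surviving_cross_edge bxy; apply/card_gt0P; exists u.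
apply/forallP=> u; apply/forallP=> v.
have [x xu] := trace_inhabited (val u); have [z zv] := trace_inhabited (val v).
have [bxz|] := eqVneq (b x) (b z); last exact: link xu zv.
(* Both ends lie in one block: route through an edge leaving that block. *)
have [y bxy] := other_block x; have [w wE] := surviving_cross_edge bxy.
apply: (@connect_trans _ _ w).
  by apply: connect_meet xu _; rewrite wE set21.
by apply: (link _ _ y z) => //; [rewrite wE set22 | rewrite -bxz eq_sym].
Qed.

End Blocks.

(** Pair consecutive vertices of an enumeration: two vertices in one block have
    ranks with the same half, so they are told apart by the parity of the
    rank. *)
Lemma pairing_exists (T : finType) :
  exists b : T -> 'I_(uphalf #|T|), forall i, #|[set y | b y == i]| <= 2.
Proof.
have half_lt (x : T) : (enum_rank x)./2 < uphalf #|T|.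
  by rewrite -[_ < _]/(_ <= _) -[_./2.+1]/(uphalf (enum_rank x).+1) uphalf_leq.
exists (fun x => Ordinal (half_lt x)) => i; rewrite -card_bool.
apply: (@leq_card_in _ _ (fun x => odd (enum_rank x))).
move=> x y; rewrite !inE => /eqP x_i /eqP y_i odd_xy.
apply/enum_rank_inj/val_inj => /=.
rewrite -[LHS]odd_double_half -[RHS]odd_double_half odd_xy; congr (_ + _.*2).
by have /(congr1 val) := etrans x_i (esym y_i).
Qed.

Theorem theorem4p8 (n : nat) (Kn : sgraph) (Kn_complete : complete Kn)
    (Kn_order : #|Kn| = n) (n_ge3 : 3 <= n) :
  outer_connected_domination_number (middle_graph Kn) = uphalf n.
Proof.
rewrite -{}Kn_order in n_ge3 *; have [b b2] := pairing_exists Kn.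
have lower (S : {set middle_graph Kn}) :
    outer_connected_dominating S -> uphalf #|Kn| <= #|S|.
  by case/andP=> domS _; exact: dominating_middle_lower_bound.
have ocS : outer_connected_dominating (block_set b).
  apply/andP; split; first exact: block_set_dominating.
  exact: block_set_outer_connected.
apply/outer_connected_domination_numberP; first by exists (block_set b).
split=> //; exists (block_set b) => //.
by apply/eqP; rewrite eqn_leq card_block_set lower.
Qed.
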